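(* Every lightlike horizontal (normal) extremal trajectory in the sub-Lorentzian Engel group starting from the origin is a reparametrization of one of the two curves $$x_1=t,\quad x_2=\pm t,\quad y=0,\quad z=\pm\tfrac13 t^3,$$ where the same sign is taken in $x_2$ and $z$.
   Context: The Engel group is $\mathbb{R}^4$ with coordinates $q=(x_1,x_2,y,z)$ and left-invariant vector fields $X_1=\partial_{x_1}-\frac{x_2}{2}\partial_y$, $X_2=\partial_{x_2}+\frac{x_1}{2}\partial_y+\frac{x_1^2+x_2^2}{2}\partial_z$. The distribution $D=\mathrm{span}\{X_1,X_2\}$ carries the Lorentzian metric $g(X_1,X_1)=-1$, $g(X_2,X_2)=1$, $g(X_1,X_2)=0$. Normal extremals are the solutions of the Hamiltonian system on $T^*\mathbb{R}^4$ with Hamiltonian $H=\frac12(-h_1^2+h_2^2)$, where $h_i=\langle\xi,X_i\rangle$, $X_3=[X_1,X_2]=\partial_y+x_1\partial_z$, $X_4=[X_1,X_3]=\partial_z$; explicitly $\dot x_1=-h_1$, $\dot x_2=h_2$, $\dot y=\frac12(x_1h_2+x_2h_1)$, $\dot z=\frac{x_1^2+x_2^2}{2}h_2$, $\dot h_1=-h_2h_3$, $\dot h_2=-h_1h_3$, $\dot h_3=-h_1h_4$, $\dot h_4=0$. The extremal trajectory $q(t)$ is lightlike if $H=0$ along it and its velocity is nonzero (so $g(\dot q,\dot q)=0$, $\dot q\ne0$). Reparametrizations may reverse orientation. *)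

(* Defs.v *)
From Stdlib Require Import Reals.
From Coquelicot Require Import Coquelicot.
Open Scope R_scope.

(** Points (x1, x2, y, z) of the Engel group; tangent and cotangent vectors
    are written in the coordinate frames d/dx1, ..., d/dz and dx1, ..., dz. *)
Definition R4 : Type := (R * R * R * R)%type.

Definition origin : R4 := (0, 0, 0, 0).

Definition X1 (q : R4) : R4 :=
  let '(x1, x2, y, z) := q in (1, 0, - x2 / 2, 0).

Definition X2 (q : R4) : R4 :=
  let '(x1, x2, y, z) := q in (0, 1, x1 / 2, (x1 ^ 2 + x2 ^ 2) / 2).

Definition pairing (xi v : R4) : R :=
  let '(a1, a2, a3, a4) := xi in
  let '(v1, v2, v3, v4) := v in
  a1 * v1 + a2 * v2 + a3 * v3 + a4 * v4.

Definition Ham (q xi : R4) : R :=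
  / 2 * (- (pairing xi (X1 q)) ^ 2 + (pairing xi (X2 q)) ^ 2).

Definition grad (f : R4 -> R) (v : R4) : R4 :=
  let '(a, b, c, d) := v in
  (Derive (fun s => f (s, b, c, d)) a,
   Derive (fun s => f (a, s, c, d)) b,
   Derive (fun s => f (a, b, s, d)) c,
   Derive (fun s => f (a, b, c, s)) d).

(** Intervals may be open, closed or half-open, bounded or not. *)
Definition nondegenerate_interval (I : R -> Prop) : Prop :=
  (forall a b t, I a -> I b -> a <= t <= b -> I t) /\
  (exists a b, I a /\ I b /\ a < b).

(** Derivative relative to [I], hence one-sided at an endpoint of [I]
    that belongs to [I]. *)
Definition has_derive_on {V : NormedModule R_AbsRing}
    (I : R -> Prop) (f : R -> V) (t : R) (l : V) : Prop :=
  filterdiff f (within I (locally t)) (fun h => scal h l).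

(** Integral curves, in canonical coordinates (q, xi) of the cotangent bundle,
    of the Hamiltonian vector field of [H]. *)
Definition hamiltonian_solution (H : R4 -> R4 -> R)
    (I : R -> Prop) (q xi : R -> R4) : Prop :=
  forall t, I t ->
    has_derive_on I q t (grad (fun w => H (q t) w) (xi t)) /\
    has_derive_on I xi t (opp (grad (fun x => H x (xi t)) (q t))).

Definition normal_extremal : (R -> Prop) -> (R -> R4) -> (R -> R4) -> Prop :=
  hamiltonian_solution Ham.

Definition lightlike_extremal_trajectory (I : R -> Prop) (q : R -> R4) : Prop :=
  exists xi : R -> R4,
    normal_extremal I q xi /\
    forall t, I t -> Ham (q t) (xi t) = 0 /\ ~ has_derive_on I q t zero.

(** [q] traverses an arc of [c] on [I] through a C^1 change of parameter with
    nowhere vanishing derivative, of either sign: orientation may be reversed. *)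
Definition reparametrization_on (I : R -> Prop) (q c : R -> R4) : Prop :=
  exists phi dphi : R -> R,
    (forall t, I t -> has_derive_on I phi t (dphi t)) /\
    continuous_on I dphi /\
    (forall t, I t -> dphi t <> 0) /\
    (forall t, I t -> q t = c (phi t)).

Definition lightlike_curve (eps : R) (s : R) : R4 :=
  (s, eps * s, 0, eps * (s ^ 3 / 3)).

(* Main.v *)
(** On a lightlike extremal [h1 ^ 2 = h2 ^ 2], and a nonvanishing velocity
    forces [h1 <> 0] and [h2 <> 0], so by continuity [h2 = - eps * h1] on the
    whole interval for one sign [eps]. The equations of motion then read
    [x2' = eps * x1'], [y' = h1 * (x2 - eps * x1) / 2] and
    [z' = eps * (x1 ^ 2 + x2 ^ 2) / 2 * x1'], so that the curve starting from
    the origin is parametrized by [x1], whose derivative [- h1] never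
    vanishes. *)
Require Import Defs.
From Stdlib Require Import Reals.
From Coquelicot Require Import Coquelicot.
From Stdlib Require Import Lra.
Open Scope R_scope.

(** * Momenta and the velocity of an extremal *)

Definition h1 (q xi : R4) : R := pairing xi (X1 q).
Definition h2 (q xi : R4) : R := pairing xi (X2 q).

(** [Ham] is a quadratic form in the pairings of [xi] with [X1] and [X2], so its gradient in [xi] is
    the horizontal vector [- h1 X1 + h2 X2], written out here in coordinates. *)
Lemma grad_Ham_covector (x1 x2 y z : R) (xi : R4) :
  let q := (x1, x2, y, z) in
  grad (fun w => Ham q w) xi =
  (- h1 q xi, h2 q xi, / 2 * (x1 * h2 q xi + x2 * h1 q xi),
   (x1 ^ 2 + x2 ^ 2) / 2 * h2 q xi).
Proof.
  destruct xi as [[[a b] c] d]; unfold grad, Ham, h1, h2; simpl.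
  repeat match goal with |- (_, _) = (_, _) => apply f_equal2 end;
    apply is_derive_unique; auto_derive; auto; field.
Qed.

(** * Differential calculus relative to a set *)

Lemma is_filter_lim_within (I : R -> Prop) (t : R) :
  is_filter_lim (within I (locally t)) t.
Proof. intros P HP; apply filter_le_within; exact HP. Qed.

Lemma within_locally_proper (I : R -> Prop) (t : R) :
  I t -> ProperFilter (within I (locally t)).
Proof.
  intros It; split; [|apply within_filter, locally_filter].
  intros P HP; exists t; exact (locally_singleton _ _ HP It).
Qed.

(** [filterdiff] imposes its little-o condition at every limit point of the filter; hence passing to
    a finer filter also requires control of the limit points. *)
Lemma filterdiff_filter_le {U V : NormedModule R_AbsRing}
    (F G : (U -> Prop) -> Prop) (f l : U -> V) :
  filter_le F G -> (forall x, is_filter_lim F x -> is_filter_lim G x) ->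
  filterdiff f G l -> filterdiff f F l.
Proof.
  intros HFG Hlim [Hl Hd]; split; [exact Hl|].
  intros x Hx eps; apply HFG, (Hd x (Hlim x Hx) eps).
Qed.

Section RelativeDerivative.

Variable I : R -> Prop.

Lemma has_derive_on_linear {V W : NormedModule R_AbsRing} (L : V -> W)
    (f : R -> V) (t : R) (l : V) :
  is_linear L -> has_derive_on I f t l ->
  has_derive_on I (fun s => L (f s)) t (L l).
Proof.
  intros HL Hf.
  apply filterdiff_ext_lin with (fun h : R => L (scal h l)).
  - apply (@filterdiff_comp _ _ _ _ _ (within_filter _ _ _ _)); [exact Hf|].
    now apply filterdiff_linear.
  - intros h; apply (linear_scal L HL).
Qed.

Lemma has_derive_on_continuous {V : NormedModule R_AbsRing}
    (f : R -> V) (t : R) (l : V) :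
  has_derive_on I f t l ->
  filterlim f (within I (locally t)) (locally (f t)).
Proof.
  intros Hf; apply filterdiff_continuous_aux.
  - eexists; exact Hf.
  - apply is_filter_lim_within.
Qed.

(** Chain rule with a two-sided outer derivative: by continuity of [f], the image of the relative
    filter refines [locally (f t)], so differentiability of [g] restricts to it. *)
Lemma has_derive_on_comp (g f : R -> R) (t l m : R) :
  I t -> has_derive_on I f t l -> is_derive g (f t) m ->
  has_derive_on I (fun s => g (f s)) t (m * l).
Proof.
  intros It Hf Hg.
  pose proof (has_derive_on_continuous _ _ _ Hf) as Hc.
  pose proof (within_locally_proper I t It) as HF.
  apply filterdiff_ext_lin with (fun h : R => scal (scal h l) m).
  - apply (@filterdiff_comp _ _ _ _ _ (within_filter _ _ _ _)
             f g (fun h => scal h l) (fun h => scal h m)); [exact Hf|].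
    apply filterdiff_filter_le with (locally (f t)); [exact Hc| |exact Hg].
    intros x Hx.
    (* The image filter is proper because [I t] holds, and it converges to [f t], so [f t] is its
       only limit point. *)
    replace x with (f t); [now intros P|].
    apply (is_filter_lim_unique (F := filtermap f (within I (locally t))));
      assumption.
  - intros h; unfold scal; simpl; unfold mult; simpl; ring.
Qed.

Lemma has_derive_on_minus (f g : R -> R) (t l m : R) :
  has_derive_on I f t l -> has_derive_on I g t m ->
  has_derive_on I (fun s => f s - g s) t (l - m).
Proof.
  intros Hf Hg.
  apply filterdiff_ext_lin with (fun h : R => minus (scal h l) (scal h m)).
  - exact (@filterdiff_minus_fct _ _ _ _ (within_filter _ _ _ _) f g
             (fun h => scal h l) (fun h => scal h m) Hf Hg).
  - intros h; unfold minus, plus, opp, scal; simpl; unfold mult; simpl; ring.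
Qed.

Lemma has_derive_on_interior (f : R -> R) (t l : R) :
  locally t I -> has_derive_on I f t l -> is_derive f t l.
Proof.
  intros HI Hf.
  apply filterdiff_filter_le with (within I (locally t)); [| |exact Hf].
  - intros P HP; generalize (filter_and _ _ HI HP).
    now apply filter_imp; intros x [Hx HPx]; apply HPx.
  - intros x Hx P HP; apply filter_le_within; exact (Hx P HP).
Qed.

(** * Constancy and sign of functions on an interval *)

Hypothesis convex : forall a b t, I a -> I b -> a <= t <= b -> I t.

(** For [a <= b] this retracts the line onto [[a, b]]. Precomposing with it extends a function
    continuous on [I] to one continuous everywhere, as suits [MVT_gen] and [IVT_gen]. *)
Definition clamp (a b t : R) : R := Rmax a (Rmin b t).

Lemma clamp_id (a b t : R) : a <= t <= b -> clamp a b t = t.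
Proof.
  intros Ht; unfold clamp; rewrite Rmin_right, Rmax_right; lra.
Qed.

Lemma clamp_bounds (a b t : R) : a <= b -> a <= clamp a b t <= b.
Proof.
  intros Hab; unfold clamp, Rmax, Rmin.
  destruct (Rle_dec b t); destruct (Rle_dec _ _); lra.
Qed.

Lemma clamp_contract (a b s t : R) :
  Rabs (clamp a b s - clamp a b t) <= Rabs (s - t).
Proof.
  unfold clamp, Rmax, Rmin, Rabs.
  repeat destruct (Rle_dec _ _); repeat destruct (Rcase_abs _); lra.
Qed.

(** The retraction is 1-Lipschitz with values in [I], so it carries ordinary neighbourhoods of [t]
    into relative neighbourhoods of its image. *)
Lemma continuous_on_clamp (f : R -> R) (a b : R) :
  continuous_on I f -> I a -> I b -> a <= b ->
  forall t, continuous (fun s => f (clamp a b s)) t.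
Proof.
  intros Hf Ia Ib Hab t.
  assert (HI : forall s, I (clamp a b s)).
  { intros s; exact (convex a b _ Ia Ib (clamp_bounds a b s Hab)). }
  apply filterlim_comp with (within I (locally (clamp a b t)));
    [|apply Hf, HI].
  intros P [d Hd]; exists d; intros s Hs; apply Hd; [|apply HI].
  exact (Rle_lt_trans _ _ _ (clamp_contract a b s t) Hs).
Qed.

Lemma has_derive_on_0_eq (f : R -> R) (a b : R) :
  (forall t, I t -> has_derive_on I f t 0) -> I a -> I b -> f a = f b.
Proof.
  intros Hf.
  assert (Hc : continuous_on I f).
  { intros t It; exact (has_derive_on_continuous _ _ _ (Hf t It)). }
  assert (Hlt : forall a b, I a -> I b -> a < b -> f a = f b).
  { clear a b; intros a b Ia Ib Hab.
    destruct (MVT_gen (fun s => f (clamp a b s)) a b (fun _ => 0))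
      as (c & _ & E).
    - rewrite Rmin_left, Rmax_right by lra; intros t Ht.
      assert (Hloc : locally t (fun s => a < s < b)).
      { apply filter_and; [apply (open_gt a t)|apply (open_lt b t)]; apply Ht. }
      (* Near an interior point of [[a, b]] the clamp is the identity, and the relative derivative
         is a two-sided one. *)
      apply is_derive_ext_loc with f.
      + revert Hloc; apply filter_imp; intros s Hs.
        rewrite clamp_id; lra.
      + apply has_derive_on_interior.
        * revert Hloc; apply filter_imp; intros s Hs.
          apply (convex a b); auto; lra.
        * apply Hf, (convex a b); auto; lra.
    - intros t _; apply continuity_pt_filterlim.
      apply continuous_on_clamp; auto; lra.
    - rewrite !clamp_id in E by lra; lra. }
  intros Ia Ib; destruct (Rtotal_order a b) as [H|[H|H]].
  - now apply Hlt.
  - now rewrite H.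
  - now symmetry; apply Hlt.
Qed.

(** Integration of [du = dg(x) dx] with [x] as the variable in place of time: the difference
    [u - g(x)] has zero derivative and vanishes at [t0]. *)
Lemma eq_comp_of_derive (u x dx g dg : R -> R) (t0 : R) :
  (forall t, I t -> has_derive_on I x t (dx t)) ->
  (forall s, is_derive g s (dg s)) ->
  (forall t, I t -> has_derive_on I u t (dg (x t) * dx t)) ->
  I t0 -> u t0 = g (x t0) ->
  forall t, I t -> u t = g (x t).
Proof.
  intros Hx Hg Hu It0 E t It.
  assert (H : u t - g (x t) = u t0 - g (x t0)); [|lra].
  apply (has_derive_on_0_eq (fun s => u s - g (x s))); auto.
  intros s Is; rewrite <- (Rminus_diag (dg (x s) * dx s)).
  apply has_derive_on_minus; [now apply Hu|].
  apply has_derive_on_comp; auto.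
Qed.

Lemma continuous_on_nonzero_sign (f : R -> R) (a b : R) :
  continuous_on I f -> (forall t, I t -> f t <> 0) -> I a -> I b ->
  0 < f a -> 0 < f b.
Proof.
  intros Hf Hnz Ia Ib Ha.
  destruct (Rlt_or_le 0 (f b)) as [|Hb]; [assumption|exfalso].
  (* The order of [a] and [b] is unknown, so the clamp goes to the segment they span. *)
  set (m := Rmin a b); set (M := Rmax a b).
  assert (Im : I m) by (unfold m, Rmin; destruct (Rle_dec a b); assumption).
  assert (IM : I M) by (unfold M, Rmax; destruct (Rle_dec a b); assumption).
  assert (HmM : m <= a <= M /\ m <= b <= M).
  { unfold m, M, Rmin, Rmax; destruct (Rle_dec a b); lra. }
  destruct (IVT_gen (fun s => f (clamp m M s)) a b 0) as (t & Ht & E).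
  - intros t; apply continuity_pt_filterlim.
    apply continuous_on_clamp; auto; lra.
  - rewrite !clamp_id by lra; rewrite Rmin_right, Rmax_left; lra.
  - apply (Hnz (clamp m M t)); [|exact E].
    apply (convex m M); auto; apply clamp_bounds; lra.
Qed.

End RelativeDerivative.

(** * Coordinates in [R4] and continuity of the momenta *)

Lemma filterlim_Rplus {T : Type} (F : (T -> Prop) -> Prop) (FF : Filter F)
    (f g : T -> R) (a b : R) :
  filterlim f F (locally a) -> filterlim g F (locally b) ->
  filterlim (fun s => f s + g s) F (locally (a + b)).
Proof.
  intros Hf Hg; eapply filterlim_comp_2; [exact Hf|exact Hg|].
  exact (filterlim_plus a b).
Qed.

Lemma filterlim_Rmult {T : Type} (F : (T -> Prop) -> Prop) (FF : Filter F)
    (f g : T -> R) (a b : R) :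
  filterlim f F (locally a) -> filterlim g F (locally b) ->
  filterlim (fun s => f s * g s) F (locally (a * b)).
Proof.
  intros Hf Hg; eapply filterlim_comp_2; [exact Hf|exact Hg|].
  exact (filterlim_mult a b).
Qed.

Definition coord1 (v : R4) : R := fst (fst (fst v)).
Definition coord2 (v : R4) : R := snd (fst (fst v)).
Definition coord3 (v : R4) : R := snd (fst v).
Definition coord4 (v : R4) : R := snd v.

Lemma R4_coords (v : R4) : v = (coord1 v, coord2 v, coord3 v, coord4 v).
Proof. destruct v as [[[a b] c] d]; reflexivity. Qed.

Lemma has_derive_on_coords (I : R -> Prop) (v : R -> R4) (t : R) (l : R4) :
  has_derive_on I v t l ->
  has_derive_on I (fun s => coord1 (v s)) t (coord1 l) /\
  has_derive_on I (fun s => coord2 (v s)) t (coord2 l) /\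
  has_derive_on I (fun s => coord3 (v s)) t (coord3 l) /\
  has_derive_on I (fun s => coord4 (v s)) t (coord4 l).
Proof.
  intros Hv.
  pose proof (has_derive_on_linear I _ _ _ _ is_linear_fst Hv) as H3.
  pose proof (has_derive_on_linear I _ _ _ _ is_linear_fst H3) as H2.
  split; [|split; [|split]].
  - exact (has_derive_on_linear I _ _ _ _ is_linear_fst H2).
  - exact (has_derive_on_linear I _ _ _ _ is_linear_snd H2).
  - exact (has_derive_on_linear I _ _ _ _ is_linear_snd H3).
  - exact (has_derive_on_linear I _ _ _ _ is_linear_snd Hv).
Qed.

(** Both momenta are polynomials in the coordinates of [q] and [xi], which are continuous because
    the Hamiltonian system makes them differentiable. *)
Lemma continuous_on_h (I : R -> Prop) (q xi : R -> R4) :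
  normal_extremal I q xi ->
  continuous_on I (fun t => h1 (q t) (xi t)) /\
  continuous_on I (fun t => h2 (q t) (xi t)).
Proof.
  intros HH; split; intros t It; destruct (HH t It) as [Hq Hxi];
    apply has_derive_on_coords in Hq as (Hx1 & Hx2 & _);
    apply has_derive_on_coords in Hxi as (Ha & Hb & Hc & Hd);
    apply has_derive_on_continuous in Hx1, Hx2, Ha, Hb, Hc, Hd;
    assert (FF : Filter (within I (locally t)))
      by apply within_filter, locally_filter.
  (* The momentum is rewritten with sums, products and constants only, the shape that the limit
     lemmas can take apart. *)
  - assert (E : forall s,
      coord1 (xi s) + coord3 (xi s) * (coord2 (q s) * (- / 2))
      = h1 (q s) (xi s)).
    { intros s; destruct (q s) as [[[? ?] ?] ?].
      destruct (xi s) as [[[? ?] ?] ?].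
      unfold h1, coord1, coord2, coord3; simpl; field. }
    rewrite <- E; apply filterlim_ext with (1 := E).
    repeat first [apply filterlim_Rplus | apply filterlim_Rmult]; auto.
    apply filterlim_const.
  - assert (E : forall s,
      coord2 (xi s) + (coord3 (xi s) * coord1 (q s) + coord4 (xi s) *
        (coord1 (q s) * coord1 (q s) + coord2 (q s) * coord2 (q s))) * / 2
      = h2 (q s) (xi s)).
    { intros s; destruct (q s) as [[[? ?] ?] ?].
      destruct (xi s) as [[[? ?] ?] ?].
      unfold h2, coord1, coord2, coord3, coord4; simpl; field. }
    rewrite <- E; apply filterlim_ext with (1 := E).
    repeat first [apply filterlim_Rplus | apply filterlim_Rmult]; auto.
    apply filterlim_const.
Qed.

(** * Lightlike extremals through the origin *)

Lemma lightlike_velocity (I : R -> Prop) (q xi : R -> R4) (t : R) :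
  normal_extremal I q xi -> I t -> Ham (q t) (xi t) = 0 ->
  ~ has_derive_on I q t zero ->
  h1 (q t) (xi t) <> 0 /\
  (h2 (q t) (xi t) = h1 (q t) (xi t) \/ h2 (q t) (xi t) = - h1 (q t) (xi t)).
Proof.
  intros HH It H0 Hnz; destruct (HH t It) as [Hq _].
  rewrite (R4_coords (q t)), grad_Ham_covector, <- R4_coords in Hq.
  change (/ 2 * (- h1 (q t) (xi t) ^ 2 + h2 (q t) (xi t) ^ 2) = 0) in H0.
  assert (E : (h2 (q t) (xi t) - h1 (q t) (xi t)) *
              (h2 (q t) (xi t) + h1 (q t) (xi t)) = 0) by nra.
  split; [|apply Rmult_integral in E; lra].
  intros Z; apply Hnz; rewrite Z in *.
  assert (Z2 : h2 (q t) (xi t) = 0) by nra; rewrite Z2 in Hq.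
  (* With both momenta zero every velocity component vanishes; [origin] is convertible to [zero]. *)
  match type of Hq with has_derive_on _ _ _ ?l =>
    replace l with origin in Hq; [exact Hq|] end.
  unfold origin; repeat apply f_equal2; field.
Qed.

Lemma reparametrization_of_sign (I : R -> Prop) (t0 eps : R) (q xi : R -> R4) :
  (forall a b t, I a -> I b -> a <= t <= b -> I t) ->
  I t0 -> q t0 = origin -> normal_extremal I q xi -> eps * eps = 1 ->
  (forall t, I t -> h1 (q t) (xi t) <> 0) ->
  (forall t, I t -> h2 (q t) (xi t) = - eps * h1 (q t) (xi t)) ->
  reparametrization_on I q (lightlike_curve eps).
Proof.
  intros convex It0 Hq0 HH Heps Hnz Hs.
  pose (dx1 t := - h1 (q t) (xi t)).
  (* Each velocity is put as a multiple of [dx1], the form in which [eq_comp_of_derive] integrates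
     it against [x1]. *)
  assert (HD : forall t, I t ->
    has_derive_on I (fun s => coord1 (q s)) t (dx1 t) /\
    has_derive_on I (fun s => coord2 (q s)) t (eps * dx1 t) /\
    has_derive_on I (fun s => coord3 (q s)) t
      (/ 2 * (eps * coord1 (q t) - coord2 (q t)) * dx1 t) /\
    has_derive_on I (fun s => coord4 (q s)) t
      (eps * ((coord1 (q t) ^ 2 + coord2 (q t) ^ 2) / 2) * dx1 t)).
  { intros t It; destruct (HH t It) as [Hq _].
    rewrite (R4_coords (q t)), grad_Ham_covector, <- R4_coords, Hs in Hq
      by assumption.
    apply has_derive_on_coords in Hq; destruct Hq as (H1 & H2 & H3 & H4).
    unfold coord1 at 2 in H1; unfold coord2 at 2 in H2.
    unfold coord3 at 2 in H3; unfold coord4 at 2 in H4; simpl in H1, H2, H3, H4.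
    unfold dx1; split; [|split; [|split]].
    - exact H1.
    - replace (eps * _) with (- eps * h1 (q t) (xi t)) by ring; exact H2.
    - match type of H3 with has_derive_on _ _ _ ?l =>
        replace (_ * _) with l by field; exact H3 end.
    - match type of H4 with has_derive_on _ _ _ ?l =>
        replace (_ * _) with l by field; exact H4 end. }
  assert (Hx1 : forall t, I t ->
    has_derive_on I (fun s => coord1 (q s)) t (dx1 t)) by (intros; now apply HD).
  assert (E2 : forall t, I t -> coord2 (q t) = eps * coord1 (q t)).
  { apply (eq_comp_of_derive I convex _ _ dx1 _ (fun _ => eps) t0); auto.
    - intros s; auto_derive; auto; ring.
    - intros; now apply HD.
    - rewrite Hq0; unfold coord1, coord2, origin; simpl; ring. }
  (* Once [x2 = eps * x1] is known, the factor [eps * x1 - x2] of the velocity of [y] vanishes. *)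
  assert (E3 : forall t, I t -> coord3 (q t) = 0).
  { apply (eq_comp_of_derive I convex _ (fun s => coord1 (q s)) dx1
             (fun _ => 0) (fun _ => 0) t0); auto.
    - intros s; auto_derive; auto.
    - intros t It; destruct (HD t It) as (_ & _ & H3 & _).
      rewrite E2 in H3 by assumption.
      match type of H3 with has_derive_on _ _ _ ?l =>
        replace (_ * _) with l by field; exact H3 end.
    - rewrite Hq0; reflexivity. }
  (* Since [eps * eps = 1], the sum [x1 ^ 2 + x2 ^ 2] equals [2 * x1 ^ 2], so
     [dz/dx1 = eps * x1 ^ 2]. *)
  assert (E4 : forall t, I t -> coord4 (q t) = eps * (coord1 (q t) ^ 3 / 3)).
  { apply (eq_comp_of_derive I convex _ (fun s => coord1 (q s)) dx1
             (fun s => eps * (s ^ 3 / 3)) (fun s => eps * s ^ 2) t0); auto.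
    - intros s; auto_derive; auto; field.
    - intros t It; destruct (HD t It) as (_ & _ & _ & H4).
      rewrite E2 in H4 by assumption.
      match type of H4 with has_derive_on _ _ _ ?l =>
        replace (_ * _) with l; [exact H4|] end.
      replace ((eps * coord1 (q t)) ^ 2) with
        (eps * eps * coord1 (q t) ^ 2) by ring.
      rewrite Heps; field.
    - rewrite Hq0; unfold coord1, coord4, origin; simpl; field. }
  exists (fun t => coord1 (q t)), dx1; split; [|split; [|split]].
  - exact Hx1.
  - intros t It.
    apply (filterlim_comp _ _ _ (fun s => h1 (q s) (xi s)) Ropp)
      with (1 := proj1 (continuous_on_h I q xi HH) t It).
    exact (filterlim_opp (h1 (q t) (xi t))).
  - intros t It; specialize (Hnz t It); unfold dx1; lra.
  - intros t It; rewrite (R4_coords (q t)) at 1; unfold lightlike_curve.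
    now rewrite E2, E3, E4.
Qed.

Theorem theorem3 :
  forall (I : R -> Prop) (t0 : R) (q : R -> R4),
    nondegenerate_interval I ->
    I t0 ->
    lightlike_extremal_trajectory I q ->
    q t0 = origin ->
    reparametrization_on I q (lightlike_curve 1) \/
    reparametrization_on I q (lightlike_curve (-1)).
Proof.
  intros I t0 q [convex _] It0 [xi [HH Hl]] Hq0.
  assert (Hv : forall t, I t -> h1 (q t) (xi t) <> 0 /\
    (h2 (q t) (xi t) = h1 (q t) (xi t) \/
     h2 (q t) (xi t) = - h1 (q t) (xi t))).
  { intros t It; now apply lightlike_velocity with I; try apply Hl. }
  pose proof (continuous_on_h I q xi HH) as [C1 C2].
  (* The sign of [h1 * h2] tells the two branches apart: positive means [h2 = h1], that is
     [eps = -1]; negative means [h2 = - h1], that is [eps = 1]. Being continuous and never zero, the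
     product keeps its sign on [I]. *)
  assert (Hc : continuous_on I (fun t => h1 (q t) (xi t) * h2 (q t) (xi t))).
  { intros t It; apply filterlim_Rmult; [|now apply C1|now apply C2].
    apply within_filter, locally_filter. }
  assert (Hc0 : forall t, I t -> h1 (q t) (xi t) * h2 (q t) (xi t) <> 0).
  { intros t It; destruct (Hv t It) as [Hnz [-> | ->]]; nra. }
  destruct (Rlt_or_le 0 (h1 (q t0) (xi t0) * h2 (q t0) (xi t0)))
    as [Hpos|Hneg].
  - right; apply reparametrization_of_sign with t0 xi; auto; [lra|apply Hv|].
    intros t It.
    pose proof (continuous_on_nonzero_sign I convex _ t0 t Hc Hc0 It0 It Hpos) as Ht;
    simpl in Ht.
    destruct (Hv t It) as [Hnz [E | E]]; rewrite E in *; [lra|nra].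
  - left; apply reparametrization_of_sign with t0 xi; auto; [lra|apply Hv|].
    intros t It; destruct (Hv t It) as [Hnz [E | E]]; [exfalso|lra].
    (* If [h2 = h1] at [t], the product is positive there, and its constant sign makes it positive
       at [t0], against [Hneg]. *)
    apply Rle_not_lt in Hneg; apply Hneg.
    apply (continuous_on_nonzero_sign I convex _ t t0 Hc Hc0 It It0).
    rewrite E; nra.
Qed.
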